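(* For a positive odd integer $m$ and an odd prime $p$ let \[ S_m = \sum_{k=0}^{\frac{p-1}{2}} (-1)^k (4k+1)^m \left( \frac{(1/2)_k}{(1)_k} \right)^3 . \] For any positive odd integer $m$, there exist integers $a_m$ and $c_m$ (depending only on $m$) such that \[ S_m \equiv a_m \left( p (-1)^{\frac{p-1}{2}} + p^3 E_{p-3} \right) + p^3 c_m \pmod{p^4} \] holds for any prime $p\ge 5$.
   Context: $(a)_k = a(a+1)\cdots(a+k-1)$ is the rising factorial, with $(a)_0=1$. $E_n$ is the $n$-th Euler number, defined by $\frac{2}{e^x+e^{-x}} = \sum_{n=0}^\infty E_n \frac{x^n}{n!}$. Congruences modulo $p^4$ between rational numbers are understood in the ring of rational numbers with denominator prime to $p$ (equivalently, in the $p$-adic integers). *)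

(* Defs.v *)
From mathcomp Require Import all_boot all_order all_algebra.

Set Implicit Arguments.
Unset Strict Implicit.
Unset Printing Implicit Defensive.

Import Order.TTheory GRing.Theory Num.Theory.
Local Open Scope ring_scope.

Definition rising (a : rat) (k : nat) : rat := \prod_(i < k) (a + i%:R).

(* A formal power series over rat is its sequence of coefficients. *)
Definition fps := nat -> rat.

Definition fps_const (c : rat) : fps := fun n => if n == 0%N then c else 0.

Definition fps_add (f g : fps) : fps := fun n => f n + g n.

Definition fps_mul (f g : fps) : fps :=
  fun n => \sum_(i < n.+1) f (n - i)%N * g i.

(* The first n coefficients of 1 / f, obtained by solving f * g = 1
   degree by degree (meaningful when f 0 != 0). *)
Fixpoint fps_inv_coefs (f : fps) (n : nat) : seq rat :=
  if n is k.+1 then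
    let s := fps_inv_coefs f k in
    rcons s (((k == 0%N)%:R - \sum_(i < k) f (k - i)%N * s`_i) / f 0%N)
  else [::].

Definition fps_inv (f : fps) : fps := fun n => (fps_inv_coefs f n.+1)`_n.

(* exp (c x) *)
Definition fps_exp (c : rat) : fps := fun n => c ^+ n / n`!%:R.

(* 2 / (e^x + e^-x) *)
Definition euler_egf : fps :=
  fps_mul (fps_const 2) (fps_inv (fps_add (fps_exp 1) (fps_exp (-1)))).

Definition euler (n : nat) : rat := n`!%:R * euler_egf n.

Lemma size_fps_inv_coefs f n : size (fps_inv_coefs f n) = n.
Proof. by elim: n => //= n IHn; rewrite size_rcons IHn. Qed.

Lemma nth_fps_inv_coefs f n i :
  (i < n)%N -> (fps_inv_coefs f n)`_i = fps_inv f i.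
Proof.
elim: n => // n IHn; rewrite ltnS leq_eqVlt => /orP[/eqP-> //|lt_in].
by rewrite /= nth_rcons size_fps_inv_coefs lt_in IHn.
Qed.

Lemma fps_mulV f : f 0%N != 0 -> fps_mul f (fps_inv f) =1 fps_const 1.
Proof.
move=> f0 n; rewrite /fps_mul big_ord_recr /= subnn {2}/fps_inv /=.
rewrite nth_rcons size_fps_inv_coefs ltnn eqxx [f 0%N * _]mulrC divfK //.
under [in X in _ + (_ - X)]eq_bigr => i _ do
  rewrite (nth_fps_inv_coefs f (ltn_ord i)).
by rewrite addrC subrK /fps_const; case: eqP.
Qed.

Lemma euler_genfun :
  fps_mul (fps_add (fps_exp 1) (fps_exp (-1))) (fun n => euler n / n`!%:R)
  =1 fps_const 2.
Proof.
set f := fps_add _ _ => n.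
have f0 : f 0%N != 0 by [].
have egfE i : euler i / i`!%:R = 2 * fps_inv f i.
  rewrite /euler mulrAC divff ?pnatr_eq0 -?lt0n ?fact_gt0 // mul1r.
  rewrite /euler_egf /fps_mul big_ord_recr /= subnn big1 ?add0r // => j _.
  by rewrite /fps_const subn_eq0 leqNgt ltn_ord mul0r.
have := fps_mulV f0 n; rewrite /fps_mul /fps_const => fV.
under eq_bigr => i _ do rewrite egfE mulrCA.
by rewrite -mulr_sumr fV; case: eqP => _; rewrite ?mulr1 ?mulr0.
Qed.

Definition p_integral (p : nat) (x : rat) : bool := coprime p `|denq x|%N.

(* x = y mod p^n in the ring of rationals with denominator prime to p *)
Definition eqmod_pX (p n : nat) (x y : rat) : Prop :=
  [/\ p_integral p x, p_integral p y
    & exists2 z : rat, p_integral p z & x - y = p%:R ^+ n * z].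

Definition Ssum (m p : nat) : rat :=
  \sum_(0 <= k < ((p - 1)./2).+1)
    (-1) ^+ k * (4 * k + 1)%N%:R ^+ m * (rising (1 / 2) k / rising 1 k) ^+ 3.

(* Main.v *)
Require Import Defs.
From mathcomp Require Import all_boot all_order all_algebra.
From mathcomp Require Import ring lra zify.

(** Write n = (p - 1) / 2 and let u_k = (-1)^k ((1/2)_k / (1)_k)^3.

    For m = 1, put the sum of (4k + 1) u_k, k <= n, in the one-parameter family
      Phi (x) = sum_(k <= n) (-1)^k (4k + 1) (1/2)_k (1/2 - x)_k (1/2 + x)_k
                             / ((1)_k (1 - x)_k (1 + x)_k),
    of which it is the value at x = 0. At x = i + 1/2 with i <= n the sum
    terminates before its truncation and equals (-1)^i (2i + 1), which a WZ
    pair proves (wp_sum_terminating). After multiplication by the product of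
    the 1 - x^2 / j^2, j <= n, Phi is a polynomial of degree at most n in x^2,
    so these n + 1 values determine it, and Lagrange interpolation at 0 gives
    an exact formula for Phi (0) as a sum of n + 1 products
    (cube_sum_interpolation). These products are easy to reduce: the even
    numbers that occur are the p - b for b odd, and pairing p - b with b makes
    nearly everything cancel. The term of the node x = p / 2 is (-1)^n p modulo
    p^4, because each pair is 1 modulo p^3; the term of x = i + 1/2 with i < n
    is 2 p^3 (-1)^i / (2i + 1)^2 modulo p^4 (cube_sum_eqm).

    The remaining sum of the 2 (-1)^i / (2i + 1)^2 is E_(p-3) modulo p
    (euler_eqm): by Fermat it is an alternating sum of (p-3)-th powers of odd
    numbers, and such sums telescope by the functional equation of the Euler
    polynomials. Hence the case m = 1, with a = 1 and c = 0 (Ssum1_eqm).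

    For larger m, telescoping k^3 (4k - 1)^(2j) u_k shows that, with
    x = 4k + 1, the sum of u_k ((x + 2)^(2j) (x + 1)^3 + (x - 2)^(2j) (x - 1)^3)
    is a boundary term, congruent to 8 p^3 modulo p^4. The polynomial in x is
    odd with even coefficients and leading term 2 x^(2j + 3). So the sum for
    m = 2j + 3 is 4 p^3 minus an integer combination of the sums for smaller
    odd exponents, with coefficients that do not depend on p, and strong
    induction concludes (Ssum_in_main_span). *)

Set Implicit Arguments.
Unset Strict Implicit.
Unset Printing Implicit Defensive.

Import Order.TTheory GRing.Theory Num.Theory.
Local Open Scope ring_scope.

(** * Congruences between p-integral rationals *)

(** Any denominator prime to p will do, not only the reduced one: this is what
    makes closure under sums and products a matter of multiplying
    denominators. *)
Lemma p_integralP p x : reflect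
  (exists d : nat, [/\ coprime p d, d != 0%N & x * d%:R \is a Num.int])
  (p_integral p x).
Proof.
apply: (iffP idP) => [pi | [d [cpd d0 xd]]].
  exists `|denq x|%N; split => //; first by rewrite absz_eq0 denq_neq0.
  by rewrite pmulrn absz_denq -numqE rpred_int_num.
apply: coprime_dvdr cpd.
have [z ez] := intrP xd.
have ez' : numq x * d%:Z = z * denq x.
  apply: (@intr_inj rat); rewrite !rmorphM /= -ez numqE; ring.
have : (denq x %| numq x * d%:Z)%Z by rewrite ez' dvdz_mull.
rewrite dvdzE abszM Gauss_dvdr //.
by rewrite coprime_sym coprime_num_den.
Qed.

Lemma pint_int p z : p_integral p z%:~R.
Proof. by rewrite /p_integral denq_int coprimen1. Qed.

Lemma pint_nat p n : p_integral p n%:R.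
Proof. by rewrite pmulrn pint_int. Qed.

Lemma pint_add p x y : p_integral p x -> p_integral p y -> p_integral p (x + y).
Proof.
move=> /p_integralP[d [cd d0 xd]] /p_integralP[e [ce e0 ye]].
apply/p_integralP; exists (d * e)%N;
  rewrite coprimeMr cd ce muln_eq0 negb_or d0 e0; split => //.
rewrite natrM (_ : (x + y) * (d%:R * e%:R) = x * d%:R * e%:R + y * e%:R * d%:R);
  last by ring.
by rewrite rpredD // rpredM // natr_int.
Qed.

Lemma pint_mul p x y : p_integral p x -> p_integral p y -> p_integral p (x * y).
Proof.
move=> /p_integralP[d [cd d0 xd]] /p_integralP[e [ce e0 ye]].
apply/p_integralP; exists (d * e)%N;
  rewrite coprimeMr cd ce muln_eq0 negb_or d0 e0; split => //.
rewrite natrM (_ : x * y * (d%:R * e%:R) = x * d%:R * (y * e%:R)); last by ring.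
by rewrite rpredM.
Qed.

Lemma pint_opp p x : p_integral p (- x) = p_integral p x.
Proof. by rewrite /p_integral denqN. Qed.

Lemma pint_sub p x y : p_integral p x -> p_integral p y -> p_integral p (x - y).
Proof. by move=> *; rewrite pint_add // pint_opp. Qed.

Lemma pint_exp p x n : p_integral p x -> p_integral p (x ^+ n).
Proof.
move=> px; elim: n => [|n IH]; first by rewrite expr0 (pint_nat p 1).
by rewrite exprS pint_mul.
Qed.

Lemma pint_sum p (I : Type) (r : seq I) (P : pred I) (F : I -> rat) :
  (forall i, P i -> p_integral p (F i)) -> p_integral p (\sum_(i <- r | P i) F i).
Proof. by move=> PF; apply: (big_ind (fun x => is_true (p_integral p x))) => //;
  [exact: (pint_nat p 0) | exact: pint_add]. Qed.

Lemma pint_inv_nat p n : prime p -> ~~ (p %| n)%N -> p_integral p (n%:R^-1).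
Proof.
move=> pr pn; have n0 : n != 0%N by apply: contraNneq pn => ->.
by rewrite /p_integral pmulrn denqVz ?prime_coprime ?eqz_nat ?absz_id ?absz_nat
  ?prime_coprime.
Qed.

Lemma pint_inv_int p (z : int) : prime p -> ~~ (p %| `|z|)%N ->
  p_integral p (z%:~R^-1).
Proof.
move=> pr pn; have n0 : z != 0 by apply: contraNneq pn => ->.
by rewrite /p_integral denqVz ?absz_id ?prime_coprime.
Qed.

(** Divisibility of the difference only, so that it makes sense for all
    rationals; the integrality of the two sides is tracked separately. *)
Definition eqm p k (x y : rat) := p_integral p ((x - y) / p%:R ^+ k).

Lemma eqm_refl p k x : eqm p k x x.
Proof. by rewrite /eqm subrr mul0r (pint_nat p 0). Qed.

Lemma eqm_sym p k x y : eqm p k x y -> eqm p k y x.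
Proof. by rewrite /eqm -pint_opp -mulNr opprB. Qed.

Lemma eqm_trans p k y x z : eqm p k x y -> eqm p k y z -> eqm p k x z.
Proof. by rewrite /eqm => h1 h2; have := pint_add h1 h2;
  rewrite -mulrDl addrA subrK. Qed.

Lemma eqm_add p k x y x' y' : eqm p k x y -> eqm p k x' y' ->
  eqm p k (x + x') (y + y').
Proof. by rewrite /eqm => h1 h2; have := pint_add h1 h2; congr p_integral;
  ring. Qed.

Lemma eqm_sub p k x y x' y' : eqm p k x y -> eqm p k x' y' ->
  eqm p k (x - x') (y - y').
Proof. by rewrite /eqm => h1 h2; have := pint_sub h1 h2; congr p_integral;
  ring. Qed.

Lemma eqm_sum p k (I : Type) (r : seq I) (P : pred I) (F G : I -> rat) :
  (forall i, P i -> eqm p k (F i) (G i)) ->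
  eqm p k (\sum_(i <- r | P i) F i) (\sum_(i <- r | P i) G i).
Proof. by move=> FG; apply: (big_ind2 (eqm p k)) => //;
  [exact: eqm_refl | move=> *; exact: eqm_add]. Qed.

Lemma eqm_mull p k c x y : p_integral p c -> eqm p k x y -> eqm p k (c * x) (c * y).
Proof. by rewrite /eqm -mulrBr -mulrA; exact: pint_mul. Qed.

Lemma eqm_exp p k x y m : p_integral p x -> p_integral p y ->
  eqm p k x y -> eqm p k (x ^+ m) (y ^+ m).
Proof.
move=> px py xy; elim: m => [|m IH]; first by rewrite !expr0; apply: eqm_refl.
rewrite !exprS; apply: (eqm_trans (eqm_mull px IH)).
by rewrite mulrC [X in eqm _ _ _ X]mulrC; apply: eqm_mull => //; exact: pint_exp.
Qed.

Lemma eqm_pmul p j k x y : prime p ->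
  eqm p k x y -> eqm p (j + k) (p%:R ^+ j * x) (p%:R ^+ j * y).
Proof.
move=> pr; have p0 : p%:R != 0 :> rat by rewrite pnatr_eq0 -lt0n prime_gt0.
rewrite /eqm -mulrBr exprD invfM mulrACA divff ?mul1r //; exact: expf_neq0.
Qed.

Lemma eqm_int p k x y : prime p -> p_integral p y -> eqm p k x y -> p_integral p x.
Proof.
move=> pr py h; have p0 : p%:R != 0 :> rat by rewrite pnatr_eq0 -lt0n prime_gt0.
rewrite -[x](subrK y) pint_add // -[x - y](divfK (expf_neq0 k p0)).
by rewrite pint_mul // pint_exp // pint_nat.
Qed.

Lemma eqm_prod1 p k (I : Type) (r : seq I) (P : pred I) (F : I -> rat) : prime p ->
  (forall i, P i -> eqm p k (F i) 1) -> eqm p k (\prod_(i <- r | P i) F i) 1.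
Proof.
move=> pr F1; apply: (big_ind (fun x => eqm p k x 1)) => //; first exact: eqm_refl.
move=> x y x1 y1; apply: (eqm_trans (y := x * 1)); last by rewrite mulr1.
by apply: eqm_mull => //; apply: eqm_int x1 => //; exact: (pint_nat p 1).
Qed.

Lemma eqm_eqmod p k x y : prime p -> p_integral p y -> eqm p k x y ->
  eqmod_pX p k x y.
Proof.
move=> pr py h; split => //; first exact: eqm_int h.
exists ((x - y) / p%:R ^+ k) => //; rewrite mulrC divfK // expf_neq0 //.
by rewrite pnatr_eq0 -lt0n prime_gt0.
Qed.

(** * The well-poised sum and its interpolation *)

Lemma rat_odd_neq0 (z : int) : 2 * z%:~R + 1 != 0 :> rat.
Proof.
have -> : 2 * z%:~R + 1 = (2 * z + 1)%:~R :> rat by rewrite rmorphD rmorphM.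
by rewrite intr_eq0; apply/eqP; lia.
Qed.

Lemma rat_odd_neq (i j : nat) : 2 * i%:R - 2 * j%:R + 1 != 0 :> rat.
Proof.
rewrite -mulrBr; have := rat_odd_neq0 (i%:Z - j%:Z).
by rewrite rmorphB.
Qed.

(** Equal to 'C(2k, k) / 4 ^ k. *)
Definition cbin k := rising (1 / 2) k / rising 1 k.

Lemma cbin0 : cbin 0 = 1.
Proof. by rewrite /cbin /rising !big_ord0 divr1. Qed.

Lemma rising1 k : rising 1 k = k`!%:R.
Proof.
elim: k => [|k IH]; first by rewrite /rising big_ord0.
by rewrite /rising big_ord_recr /= [\prod_(i < k) _]IH factS natrM mulrC -natr1
  addrC.
Qed.

Lemma cbinS k : cbin k.+1 = cbin k * ((2 * k%:R + 1) / (2 * k%:R + 2)).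
Proof.
rewrite /cbin /rising !big_ord_recr /= -/(rising _ k) -/(rising _ k).
have r0 : rising 1 k != 0 by rewrite rising1 pnatr_eq0 -lt0n fact_gt0.
have k0 : 1 + k%:R != 0 :> rat by rewrite nat1r pnatr_eq0.
have k1 : 2 * k%:R + 2 != 0 :> rat.
  by apply/eqP; have := ler0n rat k; lra.
by field; rewrite r0 k0 k1.
Qed.

(** With Y = (2x)^2, the product is that of
    (1/2 - x)_k (1/2 + x)_k / ((1 - x)_k (1 + x)_k), so that
    (4k + 1) times this is the general term of a well-poised hypergeometric
    series with parameters 1/2, 1/2 - x, 1/2 + x. At Y = 0 it is
    (-1)^k (cbin k)^3. *)
Definition wpterm (Y : rat) k :=
  (-1) ^+ k * cbin k
  * \prod_(l < k) (((2 * l%:R + 1) ^+ 2 - Y) / ((2 * l%:R + 2) ^+ 2 - Y)).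

Lemma wptermS Y k : wpterm Y k.+1 =
  - wpterm Y k * ((2 * k%:R + 1) / (2 * k%:R + 2))
  * (((2 * k%:R + 1) ^+ 2 - Y) / ((2 * k%:R + 2) ^+ 2 - Y)).
Proof. by rewrite /wpterm big_ord_recr cbinS exprS /=; ring. Qed.

(** At these values of Y, i.e. x = i + 1/2, the series terminates. *)
Definition node i : rat := (2 * i%:R + 1) ^+ 2.

Lemma even_node_neq0 i k : (2 * k%:R + 2) ^+ 2 - node i != 0.
Proof.
rewrite /node subr_sqr mulf_neq0 //; first by have := rat_odd_neq k i;
  congr (_ != 0); ring.
by apply/eqP; have := ler0n rat k; have := ler0n rat i; lra.
Qed.

Lemma wpterm_nodeS i k : wpterm (node i) k.+1 =
  - wpterm (node i) k * ((2 * k%:R + 1) / (2 * k%:R + 2))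
  * (4 * (k%:R - i%:R) * (k%:R + i%:R + 1)
     / ((2 * k%:R - 2 * i%:R + 1) * (2 * k%:R + 2 * i%:R + 3))).
Proof.
by rewrite wptermS /node; congr (_ * (_ / _)); ring.
Qed.

Lemma wpterm_shift i k : (k <= i)%N -> wpterm (node i.+1) k =
  wpterm (node i) k * ((2 * i%:R + 3) / (2 * i%:R + 1))
  * ((i%:R + 1 + k%:R) * (2 * i%:R - 2 * k%:R + 1)
     / ((i%:R + 1 - k%:R) * (2 * i%:R + 3 + 2 * k%:R))).
Proof.
elim: k => [|k IH] ki.
  rewrite /wpterm !big_ord0 cbin0; have := ler0n rat i; set I := i%:R => I0.
  by field; apply/and3P; split; apply/eqP; lra.
have k0 := ler0n rat k; have ik : k%:R + 1 <= i%:R :> rat by rewrite natr1 ler_nat.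
have o1 := rat_odd_neq i k; have o2 := rat_odd_neq k i.
have o3 : 2 * i%:R - 2 * k%:R - 1 != 0 :> rat.
  by have := rat_odd_neq i k.+1; rewrite -natr1; congr (_ != 0); ring.
rewrite !wpterm_nodeS IH 1?ltnW // -[i.+1%:R]natr1 -[k.+1%:R]natr1.
move: ik k0 o1 o2 o3; set I := i%:R; set K := k%:R => ik k0 o1 o2 o3.
field.
repeat (apply/andP; split); try (by apply/eqP; lra).
all: try by apply: contra_neq o1 => e; lra.
Qed.

(** The two terms, once normalized by the expected values of their sums, form a
    WZ pair: the sum over all k is 0, and the partial sums are given by the
    certificate on the right, a rational multiple of one term. *)
Lemma wpterm_telescope i K : (K <= i)%N ->
  \sum_(k < K.+1) (4 * k%:R + 1) *
     (wpterm (node i.+1) k / (2 * i%:R + 3) + wpterm (node i) k / (2 * i%:R + 1))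
  = 4 * (2 * K%:R + 1) * (K%:R + i%:R + 1)
    / ((2 * i%:R + 1) * (2 * K%:R + 2 * i%:R + 3)) * wpterm (node i) K.
Proof.
have I0 := ler0n rat i.
elim: K => [|K IH] ki.
  rewrite big_ord1 /wpterm !big_ord0 cbin0 /=; move: I0; set I := i%:R => I0.
  rewrite !expr0; field; repeat (apply/andP; split); apply/eqP; lra.
rewrite big_ord_recr /= IH 1?ltnW // (wpterm_shift ki) wpterm_nodeS -[K.+1%:R]natr1.
have k0 := ler0n rat K; have ik : K%:R + 1 <= i%:R :> rat by rewrite natr1 ler_nat.
have o2 := rat_odd_neq K i.
move: (wpterm _ _) => w; move: I0 ik k0 o2; set I := i%:R;
  set k := K%:R => I0 ik k0 o2.
by field; rewrite o2; repeat (apply/andP; split) => //; apply/eqP; lra.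
Qed.

Lemma wpterm_eq0 i k : (i < k)%N -> wpterm (node i) k = 0.
Proof.
move=> ik; rewrite /wpterm (bigD1 (Ordinal ik)) //=.
by rewrite /node subrr !mul0r mulr0.
Qed.

(** The terminating case of the classical evaluation 2x / sin (pi x) of the
    series, by induction on i: consecutive normalized sums cancel. *)
Lemma wp_sum_terminating i :
  \sum_(k < i.+1) (4 * k%:R + 1) * wpterm (node i) k = (-1) ^+ i * (2 * i%:R + 1).
Proof.
elim: i => [|i IH]; first by rewrite big_ord1 /wpterm big_ord0 cbin0 /= !expr0;
  ring.
have I0 := ler0n rat i.
have := wpterm_telescope (leqnn i).
under eq_bigr => k _ do
  rewrite mulrDr (mulrA _ (wpterm (node i.+1) k)) (mulrA _ (wpterm (node i) k)).
rewrite big_split /= -!mulr_suml IH => sumE.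
rewrite big_ord_recr /= wpterm_nodeS wpterm_shift //.
rewrite exprS -[i.+1%:R]natr1.
have n3 : 2 * i%:R + 3 != 0 :> rat by apply/eqP; lra.
move/(congr1 (fun x => x * (2 * i%:R + 3))): sumE;
  rewrite mulrDl divfK // => /(canRL (addrK _)) ->.
move: (wpterm _ _) ((-1) ^+ i) I0 => w s I0.
by field; repeat (apply/andP; split); apply/eqP; lra.
Qed.

Lemma wp_sum_node n i : (i <= n)%N ->
  \sum_(k < n.+1) (4 * k%:R + 1) * wpterm (node i) k = (-1) ^+ i * (2 * i%:R + 1).
Proof.
move=> le_in; rewrite -wp_sum_terminating.
rewrite -!(big_mkord xpredT (fun k => (4 * k%:R + 1) * wpterm (node i) k)).
rewrite (big_cat_nat (n := i.+1)) //= [X in _ + X]big_nat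
  [X in _ + X]big1 ?addr0 // => k /andP[ik _].
by rewrite wpterm_eq0 // mulr0.
Qed.

Lemma node_inj : injective node.
Proof.
move=> i j; rewrite /node => /eqP; rewrite eqf_sqr => /orP[] /eqP e.
  by apply/eqP; rewrite -(eqr_nat rat); apply/eqP; move: e; lra.
suff : 0 < 2 * i%:R + 1 + (2 * j%:R + 1) :> rat by rewrite e addNr ltxx.
by have := ler0n rat i; have := ler0n rat j; move: e => _ i0 j0; lra.
Qed.

Lemma lagrange_interp (K : fieldType) (n : nat) (x : nat -> K)
  (p : {poly K}) (y : K) :
  (0 < n)%N -> injective x -> (size p <= n)%N ->
  p.[y] = \sum_(i < n) p.[x i] * \prod_(l < n | l != i) ((y - x l) / (x i - x l)).
Proof.
move=> n0 xI sp; rewrite {1}(lagrange_gen n0 xI sp) horner_sum.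
apply: eq_bigr => i _; rewrite hornerM hornerC lagrangeE //; congr (_ * _).
rewrite hornerM hornerC !horner_prod mulrC -prodfV -big_split /=.
by apply: eq_bigr => l _; rewrite !hornerE.
Qed.

(** The sum of the (4k + 1) wpterm Y k for k <= n, cleared of the denominators
    (2l + 2)^2 - Y: a polynomial of degree at most n in Y, therefore
    determined by its values at the n + 1 nodes. *)
Definition wpnum n : {poly rat} := \sum_(k < n.+1)
  ((4 * k%:R + 1) * (-1) ^+ k * cbin k)%:P *
  \prod_(l < n) (if (l < k)%N then ((2 * l%:R + 1) ^+ 2)%:P - 'X
                 else ((2 * l%:R + 2) ^+ 2)%:P - 'X).

Lemma size_wpnum n : (size (wpnum n) <= n.+1)%N.
Proof.
have lin (c : rat) : (size (c%:P - 'X)%R <= 2)%N.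
  by rewrite -opprB size_polyN size_XsubC.
apply: (leq_trans (size_sum _ _ _)); apply/bigmax_leqP => k _.
rewrite mul_polyC (leq_trans (size_scale_leq _ _)) //.
apply: (leq_trans (size_poly_prod_leq _ _)); rewrite card_ord leq_subLR addnS ltnS.
apply: (@leq_trans (\sum_(l < n) 2)%N); last by rewrite sum_nat_const card_ord; lia.
by apply: leq_sum => l _; case: ifP.
Qed.

Lemma horner_wpnum n Y : (forall l : 'I_n, (2 * l%:R + 2) ^+ 2 - Y != 0) ->
  (wpnum n).[Y] = \prod_(l < n) ((2 * l%:R + 2) ^+ 2 - Y)
                  * \sum_(k < n.+1) (4 * k%:R + 1) * wpterm Y k.
Proof.
move=> nz; rewrite horner_sum mulr_sumr; apply: eq_bigr => k _.
rewrite hornerM hornerC /wpterm.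
set odds := \prod_(l < k) _; set evens := \prod_(l < n) (_ - Y).
transitivity ((4 * k%:R + 1) * (-1) ^+ k * cbin k * (evens * odds)); last by ring.
congr (_ * _).
rewrite horner_prod /odds /evens.
have kn : (k <= n)%N by rewrite -ltnS.
rewrite (big_ord_widen n (fun l =>
  ((2 * l%:R + 1) ^+ 2 - Y) / ((2 * l%:R + 2) ^+ 2 - Y))) //.
rewrite [X in _ * X]big_mkcond -big_split /=; apply: eq_bigr => l _.
by case: ifP => _; rewrite hornerD hornerN hornerC hornerX ?mulr1 //
  [RHS]mulrC divfK.
Qed.

Lemma prod_cbin k : \prod_(l < k) ((2 * l%:R + 1) ^+ 2 / (2 * l%:R + 2) ^+ 2) =
  cbin k ^+ 2.
Proof.
elim: k => [|k IH]; first by rewrite big_ord0 cbin0 expr1n.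
by rewrite big_ord_recr IH cbinS /= -expr_div_n -exprMn.
Qed.

(** Interpolation at Y = 0 of wpnum n, whose values at the nodes are known by
    the terminating evaluation: for i <= n the series at the i-th node has
    already terminated where the sum is truncated. *)
Lemma cube_sum_interpolation n :
  \sum_(k < n.+1) (-1) ^+ k * (4 * k%:R + 1) * cbin k ^+ 3 =
  \sum_(i < n.+1) (-1) ^+ i * (2 * i%:R + 1)
    * \prod_(j < n) (((2 * j%:R + 2) ^+ 2 - node i) / (2 * j%:R + 2) ^+ 2)
    * \prod_(l < n.+1 | l != i) (node l / (node l - node i)).
Proof.
have ev0 (l : nat) : (2 * l%:R + 2) ^+ 2 != 0 :> rat.
  by rewrite expf_neq0 //; apply/eqP; have := ler0n rat l; lra.
have E0 : \prod_(l < n) (2 * l%:R + 2) ^+ 2 != 0 :> rat.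
  by apply/prodf_neq0 => l _.
transitivity ((wpnum n).[0] / \prod_(l < n) (2 * l%:R + 2) ^+ 2).
  rewrite horner_wpnum => [|l]; last by rewrite subr0.
  have -> : \prod_(l < n) ((2 * l%:R + 2) ^+ 2 - 0 : rat) =
    \prod_(l < n) (2 * l%:R + 2) ^+ 2.
    by apply: eq_bigr => l _; rewrite subr0.
  rewrite [X in X / _]mulrC mulfK //; apply: eq_bigr => k _; rewrite /wpterm.
  have -> : \prod_(l < k) (((2 * l%:R + 1) ^+ 2 - 0)
      / ((2 * l%:R + 2) ^+ 2 - 0) : rat) = cbin k ^+ 2.
    by rewrite -prod_cbin; apply: eq_bigr => l _; rewrite !subr0.
  ring.
rewrite (lagrange_interp _ _ node_inj (size_wpnum n)) // mulr_suml.
apply: eq_bigr => i _; rewrite horner_wpnum => [|l]; last exact: even_node_neq0.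
rewrite wp_sum_node -1?ltnS //.
have -> : \prod_(l < n.+1 | l != i) ((0 - node l) / (node i - node l)) =
          \prod_(l < n.+1 | l != i) (node l / (node l - node i)).
  by apply: eq_bigr => l _; rewrite sub0r -[node i - _]opprB invrN mulrNN.
rewrite [in RHS]big_split /= prodfV; ring.
Qed.

(** * The cube sum modulo p^4 *)

Lemma ndvd_lt2 p k : (0 < k < 2 * p)%N -> k != p -> ~~ (p %| k)%N.
Proof.
move=> h1 /eqP h2; apply/negP => /dvdnP[[|[|m]] e]; lia.
Qed.

Lemma pint_inv_sub p (a b : nat) : prime p -> (a < p)%N -> (b < p)%N -> a != b ->
  p_integral p ((a%:R - b%:R)^-1).
Proof.
move=> pr ap bp /eqP ab.
have -> : a%:R - b%:R = (a%:Z - b%:Z)%:~R :> rat by rewrite rmorphB.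
by apply: pint_inv_int => //; apply: ndvd_lt2; [lia | apply/eqP; lia].
Qed.

(** With p = 2n + 1, the reflection e = p - b matches the even numbers e of the
    first product of the interpolation formula with the odd numbers b of the
    second one; this is the contribution of such a pair when a = 2i + 1. *)
Definition pair_factor (p b a : rat) : rat :=
  ((p - b) ^+ 2 - a ^+ 2) / (p - b) ^+ 2 * (b ^+ 2 / (b ^+ 2 - a ^+ 2)).

Lemma natr_sub_neq0 (a b : nat) : (a%:R - b%:R != 0 :> rat) = (a != b).
Proof. by rewrite subr_eq0 eqr_nat. Qed.

Lemma pair_factor_eqm p (a b : nat) : prime p -> (0 < b < p)%N -> (0 < a < p)%N ->
  a != b -> (a + b)%N != p -> eqm p 1 (pair_factor p%:R b%:R a%:R) 1.
Proof.
move=> pr /andP[b0 bp] /andP[a0 ap] ab abp; rewrite /eqm expr1 /pair_factor.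
have ib : p_integral p ((p%:R - b%:R)^-1).
  rewrite -natrB 1?ltnW // pint_inv_nat // ndvd_lt2 //; first lia.
  by apply/eqP; lia.
have iab : p_integral p ((b%:R - a%:R)^-1) by apply: pint_inv_sub;
  rewrite // eq_sym.
have isum : p_integral p ((b%:R + a%:R)^-1).
  by rewrite -natrD pint_inv_nat // ndvd_lt2 //; [lia | rewrite addnC].
have nb : p%:R - b%:R != 0 :> rat by rewrite natr_sub_neq0; apply/eqP; lia.
have nab : b%:R - a%:R != 0 :> rat by rewrite natr_sub_neq0 eq_sym.
have np : p%:R != 0 :> rat by rewrite pnatr_eq0; lia.
have nsum : b%:R + a%:R != 0 :> rat by rewrite -natrD pnatr_eq0; lia.
have -> : (((p%:R - b%:R) ^+ 2 - a%:R ^+ 2) / (p%:R - b%:R) ^+ 2 *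
    (b%:R ^+ 2 / (b%:R ^+ 2 - a%:R ^+ 2)) - 1) / p%:R =
  (p%:R - 2 * b%:R) * a%:R ^+ 2 * (p%:R - b%:R)^-1 ^+ 2 * (b%:R - a%:R)^-1 *
    (b%:R + a%:R)^-1 :> rat.
  rewrite (subr_sqr b%:R); field.
  by rewrite nb nab np nsum.
by rewrite !(pint_mul, pint_exp, pint_sub, pint_nat).
Qed.

(** For a = p the factor is (1 - 2t) / ((1 - t)^3 (1 + t)) with t = p / b,
    whose expansion is 1 - 2t^3 + ...: the terms in t and t^2 both vanish. *)
Lemma pair_factor_last_eqm p (b : nat) : prime p -> (0 < b < p)%N ->
  eqm p 3 (pair_factor p%:R b%:R p%:R) 1.
Proof.
move=> pr /andP[b0 bp]; rewrite /eqm /pair_factor.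
have ib : p_integral p ((p%:R - b%:R)^-1).
  rewrite -natrB 1?ltnW // pint_inv_nat // ndvd_lt2 //; first lia.
  by apply/eqP; lia.
have isum : p_integral p ((b%:R + p%:R)^-1).
  by rewrite -natrD pint_inv_nat // ndvd_lt2 //; [lia | apply/eqP; lia].
have nb : p%:R - b%:R != 0 :> rat by rewrite natr_sub_neq0; apply/eqP; lia.
have np : p%:R != 0 :> rat by rewrite pnatr_eq0; lia.
have nsum : b%:R + p%:R != 0 :> rat by rewrite -natrD pnatr_eq0; lia.
have -> : (((p%:R - b%:R) ^+ 2 - p%:R ^+ 2) / (p%:R - b%:R) ^+ 2 *
    (b%:R ^+ 2 / (b%:R ^+ 2 - p%:R ^+ 2)) - 1) / p%:R ^+ 3 =
  (2 * b%:R - p%:R) * (p%:R - b%:R)^-1 ^+ 3 * (b%:R + p%:R)^-1 :> rat.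
  have nb' : b%:R - p%:R != 0 :> rat by rewrite natr_sub_neq0; apply/eqP; lia.
  rewrite (subr_sqr b%:R); field.
  by rewrite nb nb' np nsum.
by rewrite !(pint_mul, pint_exp, pint_sub, pint_nat).
Qed.

(** The unmatched factors of a term of index i < n, stripped of p^3 and of its
    sign; modulo p the left-hand side is a (- 2a) / (- a^4). *)
Lemma reflected_factor_eqm p (a : nat) : prime p -> (0 < a < p)%N ->
  eqm p 1 (a%:R * (p%:R - 2 * a%:R) / ((p%:R - a%:R) ^+ 3 * (p%:R + a%:R)))
          (2 / a%:R ^+ 2).
Proof.
move=> pr /andP[a0 ap]; rewrite /eqm expr1.
have ia : p_integral p ((p%:R - a%:R)^-1).
  rewrite -natrB 1?ltnW // pint_inv_nat // ndvd_lt2 //; first lia.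
  by apply/eqP; lia.
have isum : p_integral p ((p%:R + a%:R)^-1).
  by rewrite -natrD pint_inv_nat // ndvd_lt2 //; [lia | apply/eqP; lia].
have ia' : p_integral p (a%:R^-1).
  by rewrite pint_inv_nat // ndvd_lt2 //; [lia | apply/eqP; lia].
have na : p%:R - a%:R != 0 :> rat by rewrite natr_sub_neq0; apply/eqP; lia.
have np : p%:R != 0 :> rat by rewrite pnatr_eq0; lia.
have na' : a%:R != 0 :> rat by rewrite pnatr_eq0; lia.
have nsum : p%:R + a%:R != 0 :> rat by rewrite -natrD pnatr_eq0; lia.
have -> : (a%:R * (p%:R - 2 * a%:R) / ((p%:R - a%:R) ^+ 3 * (p%:R +
  a%:R)) - 2 / a%:R ^+ 2) / p%:R =
  (4 * p%:R ^+ 2 * a%:R - 3 * a%:R ^+ 3 - 2 * p%:R ^+ 3) *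
  ((p%:R - a%:R)^-1 ^+ 3 * (p%:R + a%:R)^-1 * a%:R^-1 ^+ 2) :> rat.
  by field; rewrite na np na' nsum.
by rewrite !(pint_mul, pint_exp, pint_sub, pint_nat).
Qed.

Lemma prod_even_reflect n (f : rat -> rat) :
  \prod_(j < n) f (2 * j%:R + 2) = \prod_(j < n) f (2 * n%:R + 1 - (2 * j%:R + 1)).
Proof.
rewrite (reindex_inj rev_ord_inj) /=; apply: eq_bigr => j _.
by congr f; rewrite natrB // -natr1; ring.
Qed.

(** The node of index n is p^2, and every even number finds a partner. *)
Lemma interp_term_last n :
  \prod_(j < n) (((2 * j%:R + 2) ^+ 2 - node n) / (2 * j%:R + 2) ^+ 2)
  * \prod_(l < n.+1 | l != ord_max) (node l / (node l - node n)) =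
  \prod_(l < n) pair_factor (2 * n%:R + 1) (2 * l%:R + 1) (2 * n%:R + 1).
Proof.
rewrite (prod_even_reflect n (fun e => (e ^+ 2 - node n) / e ^+ 2)).
rewrite [X in _ * X]big_mkcond big_ord_recr eqxx /= mulr1 -big_split /=.
apply: eq_bigr => l _.
by rewrite -val_eqE /= (ltn_eqF (ltn_ord l)).
Qed.

(** The pair with b = a is incomplete, since the second product omits l = i,
    while the node p^2 has no even partner. The even number p - a contributes
    (p - a)^2 - a^2 = p (p - 2a), and the node p^2 contributes
    p^2 / (p^2 - a^2): together they account for p^3. *)
Lemma interp_term n (i : 'I_n) (p := 2 * n%:R + 1 : rat) (a := 2 * i%:R + 1) :
  \prod_(j < n) (((2 * j%:R + 2) ^+ 2 - node i) / (2 * j%:R + 2) ^+ 2)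
  * \prod_(l < n.+1 | l != widen_ord (leqnSn n) i) (node l / (node l - node i)) =
  p ^+ 3 * ((p - 2 * a) / ((p - a) ^+ 3 * (p + a)))
  * \prod_(l < n | l != i) pair_factor p (2 * l%:R + 1) a.
Proof.
rewrite (prod_even_reflect n (fun e => (e ^+ 2 - node i) / e ^+ 2)).
rewrite [X in _ * X]big_mkcond big_ord_recr /= -val_eqE /= (gtn_eqF (ltn_ord i)) /=.
have -> : \prod_(l < n) (if widen_ord (leqnSn n) l != widen_ord (leqnSn n) i
     then node l / (node l - node i) else 1) =
   \prod_(l < n | l != i) (node l / (node l - node i)).
  by rewrite [RHS]big_mkcond.
(* Set the incomplete pair apart; the other ones recombine. *)
rewrite (bigD1 i) //= [RHS]mulrC /pair_factor [X in _ = X * _]big_split /=.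
rewrite -/p -/a /node -/a -/p.
set P1 := \prod_(_ < n | _) _; set P2 := \prod_(_ < n | _) _.
have pa : p - a != 0.
  by rewrite /p /a; apply/eqP; have := ltn_ord i; rewrite -(ltr_nat rat); lra.
have psum : p + a != 0.
  by rewrite /p /a; apply/eqP; have := ler0n rat i; have := ler0n rat n; lra.
rewrite (subr_sqr p a); field.
by rewrite pa psum.
Qed.

(** The last interpolation term is p up to sign modulo p^4, every pair being 1
    modulo p^3; the others carry an explicit factor p^3, so that only their
    cofactors modulo p matter. *)
Lemma cube_sum_eqm p n : prime p -> p = (2 * n + 1)%N ->
  eqm p 4 (\sum_(k < n.+1) (-1) ^+ k * (4 * k%:R + 1) * cbin k ^+ 3)
    ((-1) ^+ n * p%:R
     + p%:R ^+ 3 * \sum_(i < n) (-1) ^+ i * (2 / (2 * i%:R + 1) ^+ 2)).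
Proof.
move=> pr pE.
have odd (j : nat) : 2 * j%:R + 1 = (2 * j + 1)%N%:R :> rat by rewrite natrD natrM.
have sg j : p_integral p ((-1) ^+ j) by rewrite pint_exp // pint_opp (pint_nat p 1).
rewrite cube_sum_interpolation big_ord_recr /= addrC; apply: eqm_add.
  rewrite -mulrA interp_term_last odd -pE -mulrA.
  apply: eqm_mull => //.
  rewrite -[X in eqm _ _ _ X]mulr1; apply: (@eqm_pmul p 1 3) => //.
  by apply: eqm_prod1 => // l _; rewrite odd; apply: pair_factor_last_eqm => //;
    have := ltn_ord l; lia.
rewrite mulr_sumr; apply: eqm_sum => i _.
rewrite -mulrA interp_term [2 * n%:R + 1]odd -pE [2 * i%:R + 1]odd.
set a := (2 * i + 1)%N; set U := \prod_(_ < _ | _) _.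
have -> : (-1) ^+ i * a%:R * (p%:R ^+ 3 * ((p%:R - 2 * a%:R) /
     ((p%:R - a%:R) ^+ 3 * (p%:R + a%:R))) * U) =
   p%:R ^+ 3 * ((-1) ^+ i * (a%:R * (p%:R - 2 * a%:R) /
     ((p%:R - a%:R) ^+ 3 * (p%:R + a%:R)) * U)) by ring.
apply: (@eqm_pmul p 3 1) => //; apply: eqm_mull => //.
have ap : (0 < a < p)%N by have := ltn_ord i; rewrite /a; lia.
have h := reflected_factor_eqm pr ap.
have hi : p_integral p (2 / a%:R ^+ 2).
  rewrite -exprVn pint_mul ?pint_exp ?(pint_nat p 2) // pint_inv_nat //.
  by apply: ndvd_lt2; [lia | apply/eqP; lia].
apply: eqm_trans (h); rewrite -[X in eqm _ _ _ X]mulr1; apply: eqm_mull.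
  exact: eqm_int h.
apply: eqm_prod1 => // l li; rewrite odd; apply: pair_factor_eqm => //.
- by have := ltn_ord l; lia.
- by apply: contra_neq li => /eqP e; apply/val_inj/eqP; move: e; rewrite /a /=; lia.
- by apply/eqP; have := ltn_ord i; have := ltn_ord l; rewrite /a; lia.
Qed.

(** * Euler numbers modulo p *)

Lemma fact_rat_neq0 n : n`!%:R != 0 :> rat.
Proof. by rewrite pnatr_eq0 -lt0n fact_gt0. Qed.

(** The coefficient of x^n in (e^x + e^-x) sum_i E_i x^i / i! = 2. *)
Lemma euler_rec n :
  \sum_(i < n.+1) 'C(n, i)%:R * (1 + (-1) ^+ (n - i)) * euler i = 2 * (n == 0%N)%:R.
Proof.
have := euler_genfun n; rewrite /fps_mul /fps_add /fps_exp /fps_const.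
move/(congr1 (fun x => n`!%:R * x)); rewrite mulr_sumr => h.
transitivity (\sum_(i < n.+1) n`!%:R *
  ((1 ^+ (n - i) / (n - i)`!%:R + (-1) ^+ (n - i) / (n - i)`!%:R)
   * (euler i / i`!%:R))).
  apply: eq_bigr => i _; rewrite expr1n.
  rewrite -(bin_fact (leq_ord i)) !natrM.
  have := fact_rat_neq0 i; have := fact_rat_neq0 (n - i) => h1 h2.
  by field; rewrite h1 h2.
rewrite h; case: n {h} => [|n] /=; first by rewrite fact0 mul1r mulr1.
by rewrite !mulr0.
Qed.

Lemma euler0 : euler 0 = 1.
Proof.
have := euler_rec 0; rewrite big_ord1 bin0 subnn expr0 /= mul1r mulr1 => h.
by apply: (@mulfI _ 2) => //; rewrite mulr1.
Qed.

(** Euler numbers are integers: in the recurrence the coefficients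
    1 + (-1)^(n - i) are 0 or 2, so that the leading 2 can be divided out. *)
Lemma pint_euler p n : p_integral p (euler n).
Proof.
elim/ltn_ind: n => n IH.
have := euler_rec n; rewrite big_ord_recr /= binn subnn expr0 mul1r.
move/(canRL (addKr _)) => h.
have -> : euler n = (n == 0%N)%:R
   - \sum_(i < n) 'C(n, i)%:R * (~~ odd (n - i))%:R * euler i.
  apply: (@mulfI _ 2) => //; rewrite h mulrBr addrC; congr (_ - _).
  rewrite mulr_sumr; apply: eq_bigr => i _.
  by rewrite -signr_odd; case: odd => /=; rewrite ?expr0 ?expr1; ring.
rewrite pint_sub ?pint_nat // pint_sum // => i _.
apply: pint_mul; last exact: IH.
by rewrite pint_mul ?pint_nat.
Qed.

(** The Appell sequence of the Euler numbers, i.e. 2^r times the r-th Euler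
    polynomial at (t + 1) / 2. *)
Definition euler_appell r (t : rat) :=
  \sum_(i < r.+1) 'C(r, i)%:R * t ^+ (r - i) * euler i.

Lemma euler_appell0 r : euler_appell r 0 = euler r.
Proof.
rewrite /euler_appell big_ord_recr /= binn subnn expr0 !mul1r big1 ?add0r // => i _.
by rewrite expr0n subn_eq0 leqNgt ltn_ord /= mulr0 mul0r.
Qed.

Lemma binom_expand (c t : rat) m N : (m < N)%N ->
  (t + c) ^+ m = \sum_(j < N) 'C(m, j)%:R * t ^+ j * c ^+ (m - j).
Proof.
move=> mN; rewrite addrC exprDn.
rewrite (big_ord_widen N (fun j =>
  (c ^+ (m - j) * t ^+ j) *+ 'C(m, j))) // big_mkcond.
apply: eq_bigr => j _; rewrite -mulr_natl; case: ltnP => [_|mj]; first by ring.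
by rewrite bin_small // !mul0r.
Qed.

Lemma mul_bin_swap r i j : ('C(r, i) * 'C(r - i, j) = 'C(r, j) * 'C(r - j, i))%N.
Proof.
case: (leqP (i + j) r) => ijr; last first.
  have z a b : (r < a + b -> 'C(r, a) * 'C(r - a, b) = 0)%N.
    move=> h; case: (leqP a r) => ar; last by rewrite bin_small.
    by rewrite ['C(r - a, b)]bin_small ?muln0 //; lia.
  by rewrite !z // addnC.
apply/eqP; rewrite -(eqn_pmul2r (fact_gt0 i)) -(eqn_pmul2r (fact_gt0 j)).
rewrite -(eqn_pmul2r (fact_gt0 (r - i - j))); apply/eqP.
have h1 := @bin_fact r i (leq_trans (leq_addr _ _) ijr).
have h2 := @bin_fact r j (leq_trans (leq_addl _ _) ijr).
have h3 : (j <= r - i)%N by lia.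
have h4 : (i <= r - j)%N by lia.
move: (bin_fact h3) (bin_fact h4); rewrite [(r - j - i)%N]subnAC => h5 h6.
transitivity (r`!); [rewrite -h1 -h5 | rewrite -h2 -h6]; nia.
Qed.

(** Expand both powers and exchange the sums: the coefficient of t^j is then
    a multiple of the left-hand side of euler_rec for r - j, which vanishes
    unless j = r. *)
Lemma euler_appellD r t : euler_appell r (t + 1) + euler_appell r (t - 1) =
  2 * t ^+ r.
Proof.
rewrite /euler_appell -big_split /=.
transitivity (\sum_(i < r.+1) \sum_(j < r.+1)
   t ^+ j * 'C(r, j)%:R * ('C(r - j, i)%:R * (1 + (-1) ^+ (r - j - i)) * euler i)).
  apply: eq_bigr => i _; rewrite !(@binom_expand _ _ (r - i) r.+1) ?ltnS
    ?leq_subr //.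
  rewrite -mulrDl -mulrDr -big_split mulr_sumr mulr_suml; apply: eq_bigr => j _ /=.
  have := congr1 (fun k => k%:R : rat) (mul_bin_swap r i j);
    rewrite !natrM expr1n subnAC => h.
  transitivity ('C(r, i)%:R * 'C(r - i, j)%:R * t ^+ j
    * (1 + (-1) ^+ (r - j - i)) * euler i); first by ring.
  by rewrite h; ring.
rewrite exchange_big /= (bigD1 ord_max) //= [X in _ + X]big1 ?addr0 => [|j jr].
  rewrite binn subnn (bigD1 ord0) //= [X in _ + X]big1 ?addr0 => [|i i0].
    by rewrite bin0 expr0 euler0; ring.
  by rewrite bin_small ?mul0r ?mulr0 // lt0n.
rewrite -mulr_sumr; apply/eqP; rewrite mulf_eq0; apply/orP; right; apply/eqP.
have jr' : (0 < r - j)%N.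
  by rewrite subn_gt0 ltn_neqAle -ltnS ltn_ord andbT; apply: contra jr => /eqP e;
    apply/eqP/val_inj.
have := euler_rec (r - j); rewrite (gtn_eqF jr') mulr0; apply: etrans.
rewrite (@big_ord_widen _ _ _ (r - j).+1 r.+1 (fun i =>
  'C(r - j, i)%:R * (1 + (-1) ^+ (r - j - i)) * euler i)); last by lia.
rewrite [RHS]big_mkcond; apply: eq_bigr => i _; case: ltnP => // ji.
by rewrite bin_small // !mul0r.
Qed.

Lemma eqm_euler_appell p k r x y : p_integral p x -> p_integral p y ->
  eqm p k x y -> eqm p k (euler_appell r x) (euler_appell r y).
Proof.
move=> px py xy; apply: eqm_sum => i _.
rewrite mulrC [X in eqm _ _ _ X]mulrC; apply: eqm_mull; first exact: pint_euler.
by apply: eqm_mull; [exact: pint_nat | exact: eqm_exp].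
Qed.

(** The alternating sum telescopes: by euler_appellD each term is a sum of two
    values of euler_appell, at 2kc and (2k + 2)c, c being 1 or -1. *)
Lemma euler_alternating_sum r n (c : rat) : c ^+ 2 = 1 ->
  2 * (\sum_(k < n) (-1) ^+ k * (c * (2 * k%:R + 1)) ^+ r) =
  euler r - (-1) ^+ n * euler_appell r (c * (2 * n%:R)).
Proof.
move=> c2; elim: n => [|n IH]; first by rewrite big_ord0 !mulr0 euler_appell0
  expr0; ring.
rewrite big_ord_recr /= mulrDr IH exprS -[n.+1%:R]natr1.
have step :
    euler_appell r (c * (2 * n%:R)) + euler_appell r (c * (2 * (n%:R + 1))) =
    2 * (c * (2 * n%:R + 1)) ^+ r.
  rewrite -euler_appellD; move/eqP: c2; rewrite sqrf_eq1 => /orP[] /eqP ->.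
    by rewrite addrC; congr (euler_appell r _ + euler_appell r _); ring.
  by congr (euler_appell r _ + euler_appell r _); ring.
by rewrite [2 * (_ * _)]mulrCA -step; ring.
Qed.

Lemma fermat_inv p (a : nat) : prime p -> (4 < p)%N -> (0 < a < p)%N ->
  eqm p 1 (a%:R ^+ (p - 3)) (a%:R ^- 2).
Proof.
move=> pr p5 /andP[a0 ap].
have na : a%:R != 0 :> rat by rewrite pnatr_eq0; lia.
have np : p%:R != 0 :> rat by rewrite pnatr_eq0; lia.
have ia : p_integral p (a%:R^-1).
  by rewrite pint_inv_nat // ndvd_lt2 //; [lia | apply/eqP; lia].
have : eqm p 1 ((a ^ p)%N%:R) a%:R.
  have h := fermat_little a pr.
  have e1 : (a ^ p)%N%:R = (a ^ p %/ p)%N%:R * p%:R + (a ^ p %% p)%N%:R :> rat.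
    by rewrite -natrM -natrD -divn_eq.
  have e2 : a%:R = (a %/ p)%N%:R * p%:R + (a %% p)%N%:R :> rat.
    by rewrite -natrM -natrD -divn_eq.
  rewrite /eqm expr1 e1 e2 h opprD addrACA subrr addr0 -mulrBl.
  by rewrite mulfK // pint_sub // pint_nat.
move/(eqm_mull (pint_exp 3 ia)); congr eqm; last by field.
rewrite natrX {1}(_ : p = (p - 3 + 3)%N); last by lia.
by rewrite exprD mulrC exprVn mulfK // expf_neq0.
Qed.

(** By Fermat, 1 / a^2 can be replaced by a^r with r = p - 3. Adding the
    alternating sums over the points 2k + 1 and - (2k + 1), which agree because
    r is even, leaves the boundary terms at p - 1 and 1 - p; modulo p these are
    at -1 and 1, where they add up to 2 * 0^r = 0. *)
Lemma euler_eqm p n : prime p -> (4 < p)%N -> p = (2 * n + 1)%N ->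
  eqm p 1 (\sum_(i < n) (-1) ^+ i * (2 / (2 * i%:R + 1) ^+ 2)) (euler (p - 3)).
Proof.
move=> pr p5 pE; set r := (p - 3)%N.
have i2 : p_integral p (2^-1).
  by apply: (@pint_inv_nat p 2) => //; apply: ndvd_lt2; [lia | apply/eqP; lia].
have odd (j : nat) : 2 * j%:R + 1 = (2 * j + 1)%N%:R :> rat by rewrite natrD natrM.
have sg j : p_integral p ((-1) ^+ j) by rewrite pint_exp // pint_opp (pint_nat p 1).
apply: (eqm_trans (y := \sum_(i < n) (-1) ^+ i * (2 * (2 * i%:R + 1) ^+ r))).
  apply: eqm_sum => i _; apply: eqm_mull => //; apply: eqm_mull;
    first exact: (pint_nat p 2).
  by apply: eqm_sym; rewrite odd; apply: fermat_inv => //; have := ltn_ord i; lia.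
have re : ~~ ssrnat.odd r by rewrite /r; lia.
have r0 : (0 < r)%N by rewrite /r; lia.
have c1 : (-1 : rat) ^+ 2 = 1 by rewrite sqrrN expr1n.
have h1 := @euler_alternating_sum r n 1 (expr1n _ 2).
have h2 := @euler_alternating_sum r n (-1) c1.
have e2 : \sum_(k < n) (-1) ^+ k * (-1 * (2 * k%:R + 1)) ^+ r =
  \sum_(k < n) (-1) ^+ k * (2 * k%:R + 1 : rat) ^+ r.
  by apply: eq_bigr => k _; rewrite mulN1r [(- (_ + _)) ^+ _]exprNn
    -[(-1) ^+ r]signr_odd (negbTE re) expr0 mul1r.
have e1 : \sum_(k < n) (-1) ^+ k * (1 * (2 * k%:R + 1)) ^+ r =
  \sum_(k < n) (-1) ^+ k * (2 * k%:R + 1 : rat) ^+ r.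
  by apply: eq_bigr => k _; rewrite mul1r.
have pn : 2 * n%:R = p%:R - 1 :> rat by rewrite pE natrD natrM; ring.
move: h1 h2; rewrite e1 e2 mul1r mulN1r pn; set S := \sum_(k < n) _ => h1 h2.
have -> : \sum_(i < n) (-1) ^+ i * (2 * (2 * i%:R + 1) ^+ r) = 2 * S.
  by rewrite mulr_sumr; apply: eq_bigr => i _; rewrite mulrCA.
have np : p%:R != 0 :> rat by rewrite pnatr_eq0; lia.
have ev : eqm p 1 (euler_appell r (p%:R - 1) + euler_appell r (- (p%:R - 1))) 0.
  have -> : 0 = euler_appell r (-1) + euler_appell r 1.
    have := euler_appellD r 0.
    by rewrite expr0n (gtn_eqF r0) mulr0 add0r sub0r addrC => ->.
  have i1 := pint_nat p 1.
  apply: eqm_add; apply: eqm_euler_appell; rewrite ?pint_opp ?pint_sub ?pint_nat //.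
    by rewrite /eqm expr1 opprK subrK divff.
  by rewrite /eqm expr1 opprB addrAC subrr add0r mulNr divff // pint_opp.
have := eqm_mull i2 (eqm_mull (sg n) ev); rewrite !mulr0 /eqm !subr0 => h.
rewrite -pint_opp; congr p_integral: h.
have -> : 2 * S = (2 * S + 2 * S) / 2 by field.
by rewrite {1}h1 h2; field.
Qed.

(** * Raising the exponent *)

Lemma SsumE m p : Ssum m p =
  \sum_(k < ((p - 1)./2).+1) (-1) ^+ k * (4 * k%:R + 1) ^+ m * cbin k ^+ 3.
Proof.
by rewrite /Ssum big_mkord; apply: eq_bigr => k _; rewrite natrD natrM.
Qed.

Lemma prime_half p : prime p -> (2 < p)%N -> p = (2 * ((p - 1)./2) + 1)%N.
Proof. by move=> pr p2; case/even_prime: pr => [|]; lia. Qed.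

Definition main_value p : rat :=
  p%:R * (-1) ^+ ((p - 1)./2) + p%:R ^+ 3 * euler (p - 3).

Lemma pint_main_value p : p_integral p (main_value p).
Proof.
have i1 := pint_nat p 1; have ip := pint_nat p p; have ie := pint_euler p (p - 3).
by apply: pint_add; apply: pint_mul; rewrite ?pint_exp ?pint_opp.
Qed.

Lemma Ssum1_eqm p : prime p -> (5 <= p)%N -> eqm p 4 (Ssum 1 p) (main_value p).
Proof.
move=> pr p5; have p2 : (2 < p)%N by lia.
have pE := prime_half pr p2; rewrite SsumE.
apply: eqm_trans (eqm_trans _ (cube_sum_eqm pr pE)) _; first exact: eqm_refl.
rewrite /main_value mulrC; apply: eqm_add; first exact: eqm_refl.
by apply: (@eqm_pmul p 3 1) => //; apply: euler_eqm.
Qed.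

(** The difference of consecutive values of Q (4k - 1) k^3 u_k, where u_k is
    (-1)^k (cbin k)^3 and u_(k+1) / u_k = - ((k + 1/2) / (k + 1))^3, is
    - u_k / 64 times the bracket. *)
Lemma cube_sum_telescope (Q : rat -> rat) n :
  \sum_(k < n.+1) (-1) ^+ k * cbin k ^+ 3 *
    (Q (4 * k%:R + 1 + 2) * (4 * k%:R + 1 + 1) ^+ 3 +
     Q (4 * k%:R + 1 - 2) * (4 * k%:R + 1 - 1) ^+ 3) =
  8 * (2 * n%:R + 1) ^+ 3 * Q (4 * n%:R + 3) * ((-1) ^+ n * cbin n ^+ 3).
Proof.
elim: n => [|n IH].
  by rewrite big_ord1 /= cbin0 (_ : 4 * 0%:R + 1 + 2 = 4 * 0%:R + 3 :> rat); ring.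
rewrite big_ord_recr IH /= cbinS [(-1) ^+ n.+1]exprS -[n.+1%:R]natr1.
have -> : 4 * (n%:R + 1) + 1 - 2 = 4 * n%:R + 3 :> rat by ring.
have -> : 4 * (n%:R + 1) + 1 + 2 = 4 * (n%:R + 1) + 3 :> rat by ring.
have n2 : 2 * n%:R + 2 != 0 :> rat by apply/eqP; have := ler0n rat n; lra.
move: (cbin n) ((-1) ^+ n) (Q _) (Q _) => c s q1 q2.
by field.
Qed.

(** Reflecting the denominators, 2n + 1 - b for odd b, makes each of the n
    factors b / (p - b), which is -1 modulo p. *)
Lemma cbin_eqm p n : prime p -> p = (2 * n + 1)%N -> eqm p 1 ((-1) ^+ n * cbin n) 1.
Proof.
move=> pr pE.
have -> : cbin n = \prod_(l < n) ((2 * l%:R + 1) / (2 * l%:R + 2)).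
  elim: n {pE} => [|n IH]; first by rewrite big_ord0 cbin0.
  by rewrite big_ord_recr cbinS IH.
rewrite big_split /= (prod_even_reflect n (fun e => e^-1)) -big_split /=.
rewrite -[X in (-1) ^+ X](card_ord n) -prodr_const -big_split /=.
apply: eqm_prod1 => // l _; rewrite /eqm expr1.
have -> : 2 * n%:R + 1 = p%:R :> rat by rewrite pE natrD natrM.
have -> : 2 * l%:R + 1 = (2 * l + 1)%N%:R :> rat by rewrite natrD natrM.
have bp : (0 < 2 * l + 1 < p)%N by have := ltn_ord l; lia.
have ib : p_integral p ((p%:R - (2 * l + 1)%N%:R)^-1).
  rewrite -natrB; last by lia.
  by apply: pint_inv_nat => //; apply: ndvd_lt2; [lia | apply/eqP; lia].
have nb : p%:R - (2 * l + 1)%N%:R != 0 :> rat by rewrite natr_sub_neq0;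
  apply/eqP; lia.
have np : p%:R != 0 :> rat by rewrite pnatr_eq0; lia.
move: ((2 * l + 1)%N%:R : rat) nb ib => b nb.
by rewrite -pint_opp; congr p_integral; field; rewrite nb np.
Qed.

(** The property to be proved of every odd power sum, phrased so that it is
    closed under integer combinations. *)
Definition in_main_span (F : nat ->
  rat) := exists a c : int, forall p, prime p -> (5 <= p)%N ->
  eqm p 4 (F p) (a%:~R * main_value p + p%:R ^+ 3 * c%:~R).

Lemma in_main_span_sub F G : in_main_span F -> in_main_span G ->
  in_main_span (fun p => F p - G p).
Proof.
move=> [a [c FE]] [b [d GE]]; exists (a - b), (c - d) => p pr p5.
have := eqm_sub (FE p pr p5) (GE p pr p5).
by rewrite !rmorphB; congr eqm; ring.
Qed.

Lemma in_main_span_scale (z : int) F : in_main_span F ->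
  in_main_span (fun p => z%:~R * F p).
Proof.
move=> [a [c FE]]; exists (z * a), (z * c) => p pr p5.
have := eqm_mull (pint_int p z) (FE p pr p5).
by rewrite !rmorphM; congr eqm; ring.
Qed.

Lemma in_main_span_sum N (F : nat -> nat -> rat) : (forall i, (i < N)%N ->
  in_main_span (F i)) ->
  in_main_span (fun p => \sum_(i < N) F i p).
Proof.
elim: N => [|N IH] FN.
  exists 0, 0 => p _ _; rewrite big_ord0 mul0r mulr0 addr0; exact: eqm_refl.
have [a [c e1]] := IH (fun i iN => FN i (ltnW iN));
  have [b [d e2]] := FN N (ltnSn N).
exists (a + b), (c + d) => p pr p5; rewrite big_ord_recr /=.
have := eqm_add (e1 p pr p5) (e2 p pr p5).
by rewrite !rmorphD; congr eqm; ring.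
Qed.

(** h (x) - h (- x), for h this polynomial, is the bracket of
    cube_sum_telescope for Q (y) = y^(2j), by parity of Q. *)
Definition step_poly j : {poly int} := ('X + 2%:P) ^+ (2 * j) * ('X + 1%:P) ^+ 3.

Lemma step_poly_monic j : step_poly j \is monic.
Proof. by rewrite /step_poly rpredM // rpredX // monicXaddC. Qed.

Lemma size_step_poly j : size (step_poly j) = (2 * j + 4)%N.
Proof.
rewrite /step_poly size_monicM ?rpredX ?monicXaddC ?monic_neq0 ?rpredX
  ?monicXaddC //.
have XE (c : int) : 'X + c%:P = 'X - (- c)%:P by rewrite polyCN opprK.
by rewrite !XE !size_exp_XsubC; lia.
Qed.

Lemma step_poly_odd j (x : rat) :
  (x + 2) ^+ (2 * j) * (x + 1) ^+ 3 + (x - 2) ^+ (2 * j) * (x - 1) ^+ 3 =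
  2 * \sum_(i < 2 * j + 4) (odd i)%:R * ((step_poly j)`_i)%:~R * x ^+ i.
Proof.
have hE (y : rat) : (y + 2) ^+ (2 * j) * (y + 1) ^+ 3 =
  \sum_(i < 2 * j + 4) ((step_poly j)`_i)%:~R * y ^+ i.
  have <- : (map_poly intr (step_poly j)).[y] = (y + 2) ^+ (2 * j) * (y + 1) ^+ 3.
    by rewrite rmorphM !rmorphXn !rmorphD /= map_polyX !map_polyC !hornerE.
  rewrite (@horner_coef_wide _ (2 * j + 4))
    ?(leq_trans (size_poly _ _)) ?size_step_poly //.
  by apply: eq_bigr => i _; rewrite coef_map.
have -> : (x - 2) ^+ (2 * j) * (x - 1) ^+ 3 =
  - ((- x + 2) ^+ (2 * j) * (- x + 1) ^+ 3).
  have -> : - x + 2 = - (x - 2) by ring.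
  by rewrite !exprM sqrrN; ring.
rewrite !hE -sumrB mulr_sumr; apply: eq_bigr => i _.
by rewrite [(- x) ^+ i]exprNn -[(-1) ^+ i]signr_odd; case: (odd i);
  rewrite /= ?expr0 ?expr1; ring.
Qed.

(** The telescoped sum is 8 p^3 times a number congruent to 1 modulo p; the
    factor 2 of step_poly_odd cancels and leaves 4 p^3. *)
Lemma step_combination_in_main_span j :
  in_main_span (fun p =>
    \sum_(i < 2 * j + 4) (odd i)%:R * ((step_poly j)`_i)%:~R * Ssum i p).
Proof.
exists 0, 4 => p pr p5; rewrite mul0r add0r.
have pE := prime_half pr (ltnW (ltnW p5)); set n := (p - 1)./2 in pE *.
have i1 := pint_nat p 1; have ip := pint_nat p p.
have pr' : p%:R = 2 * n%:R + 1 :> rat by rewrite pE natrD natrM.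
have np : p%:R != 0 :> rat by rewrite pnatr_eq0; lia.
pose U := (2 * p%:R + 1) ^+ (2 * j) * ((-1) ^+ n * cbin n) ^+ 3.
have -> : \sum_(i < 2 * j + 4) (odd i)%:R * ((step_poly j)`_i)%:~R * Ssum i p =
  p%:R ^+ 3 * (4 * U).
  apply: (@mulfI _ 2) => //; rewrite /U.
  have -> : ((-1) ^+ n * cbin n) ^+ 3 = (-1) ^+ n * cbin n ^+ 3.
    by rewrite exprMn exprAC (_ : (-1) ^+ 3 = -1) //; ring.
  have := cube_sum_telescope (fun x => x ^+ (2 * j)) n.
  rewrite -pr' (_ : 4 * n%:R + 3 = 2 * p%:R + 1); last by rewrite pr'; ring.
  under eq_bigr => k _ do rewrite step_poly_odd mulrCA mulr_sumr.
  rewrite -mulr_sumr exchange_big /= => h.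
  transitivity (8 * p%:R ^+ 3 * (2 * p%:R + 1) ^+ (2 * j)
    * ((-1) ^+ n * cbin n ^+ 3)); last by ring.
  rewrite -h; congr (_ * _); apply: eq_bigr => i _.
  by rewrite SsumE mulr_sumr; apply: eq_bigr => k _; ring.
apply: (@eqm_pmul p 3 1) => //; rewrite -[X in eqm _ _ _ X]mulr1.
apply: eqm_mull; first exact: (pint_nat p 4).
have e1 : eqm p 1 ((2 * p%:R + 1) ^+ (2 * j)) 1.
  rewrite -[X in eqm _ _ _ X](expr1n _ (2 * j)); apply: eqm_exp => //.
    by rewrite pint_add // pint_mul // (pint_nat p 2).
  by rewrite /eqm addrK expr1 mulfK // (pint_nat p 2).
have e2 : eqm p 1 (((-1) ^+ n * cbin n) ^+ 3) 1.
  have h := cbin_eqm pr pE.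
  by rewrite -[X in eqm _ _ _ X](expr1n _ 3); apply: eqm_exp => //;
    apply: eqm_int h.
apply: eqm_trans (e1); rewrite -[X in eqm _ _ _ X]mulr1; apply: eqm_mull => //.
exact: eqm_int e1.
Qed.

(** For m = 2j + 3 the combination above is monic in the m-th power sum, and
    involves only odd exponents besides. *)
Lemma Ssum_in_main_span m : odd m -> in_main_span (Ssum m).
Proof.
elim/ltn_ind: m => m IH om.
case: (leqP m 2) => m2.
  have -> : m = 1%N by lia.
  exists 1, 0 => p pr p5; rewrite mul1r mulr0 addr0; exact: Ssum1_eqm.
pose j := (m - 3)./2.
have mE : m = (2 * j + 3)%N by rewrite /j; lia.
have lead : (step_poly j)`_m = 1.
  by have := monicP (step_poly_monic j);
    rewrite lead_coefE size_step_poly mE addn4 addn3.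
have [a [c h]] : in_main_span (fun p =>
  \sum_(i < 2 * j + 4) (odd i)%:R * ((step_poly j)`_i)%:~R * Ssum i p
   - \sum_(i < m) (odd i)%:R * ((step_poly j)`_i)%:~R * Ssum i p).
  apply: in_main_span_sub; first exact: step_combination_in_main_span.
  apply: (in_main_span_sum (F := fun i p =>
    (odd i)%:R * ((step_poly j)`_i)%:~R * Ssum i p)) => i im.
  case: (boolP (odd i)) => oi; last first.
    by exists 0, 0 => p _ _; rewrite !mul0r mulr0 addr0; exact: eqm_refl.
  have [a [c h]] := in_main_span_scale (step_poly j)`_i (IH i im oi).
  by exists a, c => p pr p5; rewrite mul1r; exact: h.
exists a, c => p pr p5; have := h p pr p5.
rewrite (_ : (2 * j + 4 = m.+1)%N); last by lia.
by rewrite big_ord_recr /= om lead !mul1r [X in eqm _ _ X _]addrC addKr.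
Qed.

Theorem theorem4 :
  forall m : nat, (0 < m)%N -> odd m ->
  exists a c : int,
    forall p : nat, prime p -> (5 <= p)%N ->
      eqmod_pX p 4 (Ssum m p)
        (a%:~R * (p%:R * (-1) ^+ ((p - 1)./2) + p%:R ^+ 3 * euler (p - 3))
         + p%:R ^+ 3 * c%:~R).
Proof.
move=> m _ om; have [a [c h]] := Ssum_in_main_span om; exists a, c => p pr p5.
apply: eqm_eqmod => //; last exact: h.
have ip := pint_nat p p.
by rewrite pint_add // pint_mul ?pint_exp ?pint_int //; exact: pint_main_value.
Qed.
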